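(* Let $\vartriangle$ be a border continuous t-norm on $[0,1]$. Then $\wedge_\vartriangle$ is a t-norm on $(\mathbf{L},\sqsubseteq)$, and for all $f,g\in\mathbf{L}$ and $x\in[0,1]$, $$(f\wedge_\vartriangle g)(x)=\begin{cases} f(x)\vee g(x), & x\in f^+\cap g^+,\\ f(x),& x\in g^+\setminus f^+,\\ g(x), & x\in f^+\setminus g^+, \\ f(x)\vartriangle g(x), & x\notin f^+\cup g^+.\end{cases}$$
   Context: $\mathbf{M}$ is the set of all functions $[0,1]\to[0,1]$; $\wedge$, $\vee$ denote minimum and maximum. For binary operations $\ast,\vartriangle$ on $[0,1]$, the convolution $\ast_\vartriangle:\mathbf{M}^2\to\mathbf{M}$ is $(f\ast_\vartriangle g)(x)=\sup\{f(y)\vartriangle g(z)\mid y,z\in[0,1],\ y\ast z=x\}$, with $\sup\varnothing=0$; $\wedge_\vartriangle$ is the case $\ast=\wedge$. The relation $\sqsubseteq$ is: $f\sqsubseteq g$ iff $f\wedge_\wedge g=f$ (where $\wedge_\wedge$ is the convolution with $\ast=\vartriangle=\wedge$). $f\in\mathbf{M}$ is normal if $\sup_{x}f(x)=1$, and convex if $x\le y\le z$ implies $f(x)\wedge f(z)\le f(y)$. $\mathbf{L}$ is the set of all normal convex elements of $\mathbf{M}$; $(\mathbf{L},\sqsubseteq)$ is a bounded poset with least element $\bar 0$ and greatest element $\bar 1$, where $\bar a$ is the characteristic function of $\{a\}$. For $f\in\mathbf{L}$, $f^+=\bigcup\{[0,a]\mid a\in[0,1],\ f\text{ is monotone increasing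 (non-decreasing) on }[0,a]\}$. A t-norm on a bounded poset $(P,\le,0_P,1_P)$ is a binary operation $P^2\to P$ that is associative, commutative, monotone increasing in each argument, and has unit $1_P$. ''$\wedge_\vartriangle$ is a t-norm on $(\mathbf{L},\sqsubseteq)$'' means that $\wedge_\vartriangle$ maps $\mathbf{L}^2$ into $\mathbf{L}$ and its restriction is a t-norm. A t-norm on $[0,1]$ is border continuous if it is continuous on the boundary $[0,1]^2\setminus(0,1)^2$ of the unit square. *)

(* Defs.v *)
From HB Require Import structures.
From mathcomp Require Import all_boot all_order all_algebra.
From mathcomp Require Import interval_inference.
From mathcomp Require Import all_classical all_reals all_analysis.

Set Implicit Arguments.
Unset Strict Implicit.
Unset Printing Implicit Defensive.

Import Order.TTheory GRing.Theory Num.Theory.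
Import numFieldNormedType.Exports.

Local Open Scope classical_set_scope.
Local Open Scope ring_scope.

(* {i01 R} carries the order of R; it is completed here into a bounded order
   and given the topology induced by R. *)
Section UnitInterval.
Variable R : realType.
Notation I := {i01 R}.

Definition zero01 : I := 0%:i01.
Definition one01 : I := 1%:i01.

Lemma i01_ge0 (x : I) : zero01 <= x.
Proof. by rewrite -num_le /=. Qed.

Lemma i01_le1 (x : I) : x <= one01.
Proof. by rewrite -num_le /=. Qed.

HB.instance Definition _ := Order.hasBottom.Build ring_display I i01_ge0.
HB.instance Definition _ := Order.hasTop.Build ring_display I i01_le1.
HB.instance Definition _ :=
  PseudoMetric.copy I (@initial_topology I R (fun x => x%:num)).

(* supremum in [0,1], equal to 0 on the empty set *)
Definition supI (A : set I) : I := supremum zero01 A.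

Lemma supIP (A : set I) (u : I) : supI A <= u <-> (forall t, A t -> t <= u).
Proof.
have [->|/set0P A0] := eqVneq A set0.
  by rewrite /supI supremum0; split => // _; exact: i01_ge0.
have [s [sub slb]] : supremums A !=set0.
  have supA : has_sup [set x%:num | x in A].
    split; first by case: A0 => a Aa; exists a%:num, a.
    by exists 1 => _ [a _ <-].
  have s0 : 0 <= sup [set x%:num | x in A].
    case: A0 => a Aa; apply: (@le_trans _ _ a%:num) => //.
    by apply: ub_le_sup; [case: supA|exists a].
  have s1 : sup [set x%:num | x in A] <= 1.
    by apply: ge_sup; [case: supA|move=> _ [a _ <-]].
  exists (Itv01 s0 s1); split => [a Aa|v vA]; rewrite -num_le /=.
    by apply: ub_le_sup; [case: supA|exists a].
  apply: ge_sup; first by case: supA.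
  by move=> _ [a Aa <-]; rewrite num_le; exact: vA.
have -> : supI A = s.
  rewrite /supI /supremum; case: ifPn => [/eqP A00|_].
    by case: A0 => a; rewrite A00.
  apply: (@is_subset1_supremums _ _ A); last by split.
  by case: xgetP => [y _ //|/(_ s)]; case; split.
by split => [su t At|uA]; [apply: le_trans su; exact: sub|exact: slb].
Qed.

End UnitInterval.

Arguments zero01 {R}.
Arguments one01 {R}.

Record is_tnorm d (P : tbPOrderType d) (op : P -> P -> P) : Prop := IsTNorm {
  tnormA : associative op ;
  tnormC : commutative op ;
  tnorm_homol : forall z, {homo (fun x => op x z) : x y / (x <= y)%O} ;
  tnorm_homor : forall z, {homo (fun x => op z x) : x y / (x <= y)%O} ;
  tnorm_1l : left_id \top%O op ;
  tnorm_1r : right_id \top%O op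
}.

Section TruthValues.
Variable R : realType.
Notation I := {i01 R}.
Notation M := (I -> I).
Implicit Types (f g h : M) (star tri : I -> I -> I).

(* continuity, as a function on the closed unit square, at each boundary
   point of the square *)
Definition border_continuous tri : Prop :=
  forall p : I * I,
    (~` ([set` `]zero01, one01[] `*` [set` `]zero01, one01[])) p ->
    {for p, continuous (fun q : I * I => tri q.1 q.2)}.

Definition convolution star tri f g : M := fun x =>
  supI [set tri (f p.1) (g p.2) | p in [set p : I * I | star p.1 p.2 = x]].

Definition sqsubseteq f g : Prop := convolution Order.min Order.min f g = f.

Definition normal_fun f : Prop := supI (range f) = one01.

Definition convex_fun f : Prop :=
  forall x y z : I, x <= y -> y <= z -> Order.min (f x) (f z) <= f y.

Definition char_fun (a : I) : M := fun x => if x == a then one01 else zero01.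

Definition fplus f : set I :=
  \bigcup_(a in [set a | {in `[zero01, a] &,
                            {homo f : x y / x <= y}}])
    [set` `[zero01, a]].

Record L := MkL {
  L_fun :> I -> I ;
  L_normal : normal_fun L_fun ;
  L_convex : convex_fun L_fun
}.

Lemma L_eq (f g : L) : (f : M) = g -> f = g.
Proof.
case: f g => [f f1 f2] [g g1 g2] /= fg; subst g.
by congr MkL; exact: Prop_irrelevance.
Qed.

Lemma convolutionP star tri f g x u :
  convolution star tri f g x <= u <->
  (forall y z : I, star y z = x -> tri (f y) (g z) <= u).
Proof.
split=> [/supIP H y z yzx|H]; first by apply: H; exists (y, z).
by apply/supIP => _ [[y z] /= yzx <-]; exact: H.
Qed.

Lemma convolution_ge star tri f g y z :
  tri (f y) (g z) <= convolution star tri f g (star y z).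
Proof. by apply: (proj1 (convolutionP _ _ _ _ _ _) (lexx _)). Qed.

Lemma minsupIP (A : set I) (t u : I) :
  Order.min (supI A) t <= u <-> (forall s, A s -> Order.min s t <= u).
Proof.
have [tu|ut] := leP t u.
  by split=> [_ s _|_]; rewrite ge_min tu orbT.
rewrite ge_min (leNgt t) ut orbF; split=> [/supIP H s As|H].
  by rewrite ge_min H.
by apply/supIP => s /H; rewrite ge_min (leNgt t) ut orbF.
Qed.

Local Notation meet := (convolution Order.min Order.min).

Lemma meetC : commutative meet.
Proof.
move=> f g; apply/funext => x; apply/le_anti/andP; split.
all: apply/convolutionP => y z <-; rewrite minC (minC y).
all: exact: (@convolution_ge Order.min Order.min).
Qed.

Lemma meet3P f g h x u : meet (meet f g) h x <= u <->
  (forall a b c : I, Order.min (Order.min a b) c = x ->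
     Order.min (Order.min (f a) (g b)) (h c) <= u).
Proof.
split=> [/convolutionP H a b c abcx|H].
  by have /minsupIP := H _ _ abcx; apply; exists (a, b).
apply/convolutionP => y c ycx; apply/minsupIP => _ [[a b] /= aby <-].
by apply: H; rewrite aby.
Qed.

Lemma meetA : associative meet.
Proof.
move=> f g h; apply/funext => x; apply/le_anti/andP; split.
  rewrite meetC (meetC g); apply/meet3P => c b a cba.
  rewrite minC (minC (h c)) minA.
  have := proj1 (meet3P f g h x _) (lexx _); apply.
  by rewrite -cba [RHS]minC (minC c) minA.
apply/meet3P => a b c abc.
rewrite -minA minC (minC (g b)); rewrite meetC (meetC g).
have := proj1 (meet3P h g f x _) (lexx _); apply.
by rewrite -abc -minA minC (minC b).
Qed.

Lemma meetxx f : meet f f = f.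
Proof.
apply/funext => x; apply/le_anti/andP; split.
  apply/convolutionP => y z; rewrite /Order.min; case: ifP => _ <-.
    by rewrite -/(Order.min _ _) ge_min lexx.
  by rewrite -/(Order.min _ _) ge_min lexx orbT.
by have := convolution_ge Order.min Order.min f f x x; rewrite !minxx.
Qed.

Lemma char_fun_normal a : normal_fun (char_fun a).
Proof.
apply/le_anti/andP; split; first exact: i01_le1.
apply: (proj1 (supIP _ _) (lexx _)); exists a => //.
by rewrite /char_fun eqxx.
Qed.

Lemma char_fun_convex a : convex_fun (char_fun a).
Proof.
move=> x y z xy yz; rewrite /char_fun.
case: (x =P a) => [xa|_]; last by rewrite ge_min i01_ge0.
case: (z =P a) => [za|_]; last by rewrite ge_min i01_ge0 orbT.
suff -> : y == a by rewrite ge_min lexx.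
by rewrite eq_le -{1}za yz -xa xy.
Qed.

Definition char_L a : L := MkL (@char_fun_normal a) (@char_fun_convex a).

HB.instance Definition _ := gen_eqMixin L.
HB.instance Definition _ := gen_choiceMixin L.

Definition le_L (f g : L) : bool := `[< sqsubseteq f g >].

Lemma le_L_refl : reflexive le_L.
Proof. by move=> f; apply/asboolP; exact: meetxx. Qed.

Lemma le_L_anti : antisymmetric le_L.
Proof.
move=> f g /andP[/asboolP fg /asboolP gf]; apply: L_eq.
by rewrite -fg meetC gf.
Qed.

Lemma le_L_trans : transitive le_L.
Proof.
move=> g f h /asboolP fg /asboolP gh; apply/asboolP.
by rewrite /sqsubseteq -{1}fg -meetA gh fg.
Qed.

HB.instance Definition _ := Order.Le_isPOrder.Build (Order.Disp tt tt) L
  le_L_refl le_L_anti le_L_trans.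

Lemma le_L_bottom (f : L) : (char_L zero01 <= f)%O.
Proof.
apply/asboolP/funext => x; apply/le_anti/andP; split.
  apply/convolutionP => y z; rewrite /= /char_fun.
  case: (y =P _) => [->|_ _]; last by rewrite ge_min i01_ge0.
  by rewrite (min_idPl (i01_ge0 z)) => <-; rewrite eqxx i01_le1.
rewrite [leLHS]/= [leLHS]/char_fun; case: eqP => [->|_]; last exact: i01_ge0.
rewrite -(L_normal f); apply/supIP => _ [z _ <-].
have := convolution_ge Order.min Order.min (char_L zero01) f zero01 z.
by rewrite (min_idPl (i01_ge0 z)) /= /char_fun eqxx (min_idPr (i01_le1 _)).
Qed.

Lemma le_L_top (f : L) : (f <= char_L one01)%O.
Proof.
apply/asboolP/funext => x; apply/le_anti/andP; split.
  apply/convolutionP => y z; rewrite /= /char_fun.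
  case: (z =P _) => [->|_ _]; last by rewrite ge_min i01_ge0 orbT.
  by rewrite (min_idPl (i01_le1 y)) => ->; rewrite ge_min lexx.
have := convolution_ge Order.min Order.min f (char_L one01) x one01.
by rewrite (min_idPl (i01_le1 x)) /= /char_fun eqxx (min_idPl (i01_le1 _)).
Qed.

HB.instance Definition _ := Order.hasBottom.Build (Order.Disp tt tt) L le_L_bottom.
HB.instance Definition _ := Order.hasTop.Build (Order.Disp tt tt) L le_L_top.

End TruthValues.

(* Main.v *)
Require Import Defs.
From mathcomp Require Import all_boot all_order all_algebra.
From mathcomp Require Import interval_inference.
From mathcomp Require Import all_classical all_reals all_analysis.
Set Implicit Arguments.
Unset Strict Implicit.
Unset Printing Implicit Defensive.
Local Open Scope classical_set_scope.
Local Open Scope ring_scope.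

(** For [f] normal and convex put [f^R x = sup_(y >= x) f y] ([tail f x]).
    This supremum is [1] on [f^+], and off [f^+] it is attained at [x].
    Border continuity makes the t-norm commute with suprema equal to [1], and
    monotonicity makes it commute with attained suprema, so that, writing [*]
    for the convolution and [.] for the t-norm,
      [f * g = max (f . g^R) (f^R . g)]   and   [(f * g)^R = f^R . g^R].
    The case formula, closure of [L], associativity (both bracketings give
    [max (f . g^R . h^R) (f^R . g . h^R) (f^R . g^R . h)]) and monotonicity
    ([f] is below [g] iff [f <= g^R] and [min (f^R) g <= f]) all follow from
    these two identities. *)

Import Order.TTheory GRing.Theory Num.Theory.
Import numFieldNormedType.Exports.

(** * Suprema over upper rays and the two regimes given by $f^+$ *)

Section Tail.
Variable R : realType.
Notation I := {i01 R}.
Implicit Types (f g h : I -> I) (x y z u v t : I) (A : set I).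

Lemma le_supI A t : A t -> t <= supI A.
Proof. by move: t; exact: (proj1 (supIP _ _) (lexx _)). Qed.

Lemma supI_le A u : (forall t, A t -> t <= u) -> supI A <= u.
Proof. by move=> Au; apply/supIP. Qed.

Definition tail f x : I := supI [set f y | y in [set y | x <= y]].

Lemma le_tail f x y : x <= y -> f y <= tail f x.
Proof. by move=> xy; apply: le_supI; exists y. Qed.

Lemma tail_le f x u : (forall y, x <= y -> f y <= u) -> tail f x <= u.
Proof. by move=> fu; apply: supI_le => _ [y xy <-]; exact: fu. Qed.

Lemma fplusP f x :
  fplus f x <-> (forall y z, y <= z -> z <= x -> f y <= f z).
Proof.
split=> [[a fa] /= xa y z yz zx|fx].
  move: xa; rewrite in_itv /= => /andP[_ xa].
  apply: fa => //; rewrite in_itv /= i01_ge0 /=; last exact: le_trans xa.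
  exact: le_trans yz (le_trans zx xa).
exists x; last by rewrite /= in_itv /= i01_ge0 lexx.
by move=> y z _; rewrite in_itv /= => /andP[_ zx] yz; exact: fx.
Qed.

Lemma tail_fplus f x : Defs.normal_fun f -> fplus f x -> tail f x = one01.
Proof.
move=> f1 /fplusP fx; apply/le_anti; rewrite i01_le1 /= -[leLHS]f1.
apply: supI_le => _ [y _ <-]; have [xy|/ltW yx] := leP x y; first exact: le_tail.
by apply: le_trans (fx _ _ yx (lexx x)) _; exact: le_tail.
Qed.

(** Off $f^+$ there is a strict drop [f z < f y] with [y <= z <= x]. Convexity on [y, z, x] gives
    [f x <= f z < f y], and then convexity on [y, x, w] rules out [f x < f w] for any [w >= x]. *)
Lemma tail_Nfplus f x : convex_fun f -> ~ fplus f x -> tail f x = f x.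
Proof.
move=> fconv fx; apply/le_anti; rewrite le_tail ?andbT //.
apply: tail_le => w xw; rewrite leNgt; apply/negP => fxw; apply: fx.
apply/fplusP => y z yz zx; rewrite leNgt; apply/negP => fzy.
have := fconv _ _ _ yz zx; rewrite ge_min leNgt fzy /= => fxz.
have := fconv _ _ _ (le_trans yz zx) xw.
by rewrite ge_min leNgt (le_lt_trans fxz fzy) leNgt fxw.
Qed.

End Tail.

(** * The tail identities for the convolution, closure of $\mathbf{L}$, associativity *)

Section Convolution.
Variables (R : realType) (tri : {i01 R} -> {i01 R} -> {i01 R}).
Notation I := {i01 R}.
Implicit Types (f g h : L R) (x y z u v t : I) (A : set I).

(** Order form of continuity in the second argument at 1: an upper bound of all [tri u t], [t] in
    [A], also bounds [tri u one01], which is [u]. Being free of topology, it can also be checked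
    directly for [min]. *)
Definition sup_continuous_at_one := forall A u v,
  supI A = one01 -> (forall t, A t -> tri u t <= v) -> u <= v.

Lemma border_sup_continuous : is_tnorm tri -> border_continuous tri ->
  sup_continuous_at_one.
Proof.
move=> triT triB A u v A1 Av; rewrite leNgt; apply/negP => vu.
have /triB triu1 : (~` ([set` `]zero01, one01[] `*` [set` `]zero01, one01[]))
  (u, one01 : I) by move=> [_] /=; rewrite in_itv /= ltxx andbF.
have : \forall t \near (one01 : I), v < tri u t.
  have vnbhs : nbhs (tri u one01) [set w : I | v < w].
    rewrite (tnorm_1r triT).
    apply/nbhs_ballP; exists (u%:num - v%:num) => /=.
      by rewrite subr_gt0 num_lt.
    move=> w uw; have {}uw : `|u%:num - w%:num| < u%:num - v%:num := uw.
    rewrite /= -num_lt; have := le_lt_trans (ler_norm _) uw.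
    by rewrite ltrD2l ltrN2.
  have [[P Q] [/= Pu Q1] PQ] := triu1 _ vnbhs.
  apply: filterS Q1 => t Qt; apply: (PQ (u, t)); split=> //.
  exact: nbhs_singleton Pu.
move=> /nbhs_ballP[e /= e0 eball].
(* Points above [1 - e / 2] lie in the ball of radius [e] around 1, where [v < tri u t]. So [c],
   truncated at 0 to stay in the unit interval, bounds [A] strictly below 1. *)
pose c : R := Num.max 0 (1 - e / 2).
have c0 : 0 <= c by rewrite le_max lexx.
have c1 : c <= 1 by rewrite ge_max ler01 lerBlDr lerDl divr_ge0 // ltW.
have : (one01 : I) <= Itv01 c0 c1.
  rewrite -A1; apply: supI_le => t At; rewrite leNgt; apply/negP.
  rewrite -num_lt /= gt_max => /andP[_ et].
  suff : v < tri u t by rewrite ltNge Av.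
  apply: eball; suff : `|1 - t%:num| < e by [].
  rewrite ger0_norm ?subr_ge0 // ltrBlDr -ltrBlDl (lt_trans _ et) // ltrD2l ltrN2.
  by rewrite gtr_pMr // invf_lt1 // ltr1n.
by rewrite -num_le /= le_max ler10 /= lerDl oppr_ge0 leNgt divr_gt0.
Qed.

Hypothesis triT : is_tnorm tri.
Hypothesis tri1 : sup_continuous_at_one.

Local Notation conv := (convolution Order.min tri).

Lemma tri_le x y u v : x <= y -> u <= v -> tri x u <= tri y v.
Proof.
by move=> xy uv; apply: le_trans (tnorm_homol triT _ xy) (tnorm_homor triT _ uv).
Qed.

Lemma tri_lel x y : tri x y <= x.
Proof. by rewrite -[leRHS](tnorm_1r triT) tri_le ?i01_le1. Qed.

Lemma tri_ler x y : tri x y <= y.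
Proof. by rewrite (tnormC triT) tri_lel. Qed.

Lemma tri_maxl x y z : tri (Order.max x y) z = Order.max (tri x z) (tri y z).
Proof.
by have [xy|/ltW yx] := leP x y; apply/esym; [apply/max_idPr|apply/max_idPl];
  rewrite tri_le.
Qed.

Lemma tri_maxr x y z : tri z (Order.max x y) = Order.max (tri z x) (tri z y).
Proof. by rewrite !(tnormC triT z) tri_maxl. Qed.

Lemma tri_minl x y z : tri (Order.min x y) z = Order.min (tri x z) (tri y z).
Proof.
by have [xy|/ltW yx] := leP x y; apply/esym; [apply/min_idPl|apply/min_idPr];
  rewrite tri_le.
Qed.

Lemma tri_tail_le f u v x :
  (forall y, x <= y -> tri u (f y) <= v) -> tri u (tail f x) <= v.
Proof.
move=> fv; have [fx|fx] := pselect (fplus f x); last first.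
  by rewrite tail_Nfplus ?fv //; exact: L_convex.
have f1 := tail_fplus (@L_normal _ f) fx.
rewrite f1 (tnorm_1r triT); apply: (tri1 f1) => _ [y xy <-]; exact: fv.
Qed.

Lemma tri_tail2_le f g v x :
  (forall y z, x <= y -> x <= z -> tri (f y) (g z) <= v) ->
  tri (tail f x) (tail g x) <= v.
Proof.
move=> fgv; apply: tri_tail_le => z xz; rewrite (tnormC triT).
by apply: tri_tail_le => y xy; rewrite (tnormC triT); exact: fgv.
Qed.

(** If [min y z = x], one coordinate equals [x] and the other ranges over the points above [x]; the
    two terms collect these two families of pairs. *)
Lemma convE f g x :
  conv f g x = Order.max (tri (f x) (tail g x)) (tri (tail f x) (g x)).
Proof.
apply/le_anti/andP; split.
  apply/convolutionP => y z <-; rewrite le_max.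
  by case: (leP y z) => [yz|/ltW zy]; apply/orP; [left|right];
    rewrite tri_le ?le_tail.
rewrite ge_max; apply/andP; split.
  apply: tri_tail_le => y xy.
  by have := convolution_ge Order.min tri f g x y; rewrite (min_idPl xy).
rewrite (tnormC triT); apply: tri_tail_le => y xy; rewrite (tnormC triT).
by have := convolution_ge Order.min tri f g y x; rewrite (min_idPr xy).
Qed.

(** The condition [x <= min y z] decouples into [x <= y] and [x <= z], so the two suprema can be
    taken independently. *)
Lemma tail_conv f g x : tail (conv f g) x = tri (tail f x) (tail g x).
Proof.
apply/le_anti/andP; split.
  apply: tail_le => w xw; apply/convolutionP => y z yzw.
  move: xw; rewrite -yzw le_min => /andP[xy xz].
  by rewrite tri_le ?le_tail.
apply: tri_tail2_le => y z xy xz.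
apply: le_trans (convolution_ge Order.min tri f g y z) _.
by apply: le_tail; rewrite le_min xy.
Qed.

Lemma tail0 (f : I -> I) : Defs.normal_fun f -> tail f zero01 = one01.
Proof.
move=> f1; rewrite -[RHS]f1; congr supI; apply/seteqP; split => _ [y _ <-].
  by exists y.
by exists y => //; exact: i01_ge0.
Qed.

Lemma conv_normal f g : Defs.normal_fun (conv f g).
Proof.
apply/le_anti; rewrite i01_le1 /=.
have <- : tail (conv f g) zero01 = one01.
  by rewrite tail_conv !tail0 ?(tnorm_1r triT) //; exact: L_normal.
by apply: tail_le => y _; apply: le_supI; exists y.
Qed.

(** If [y] lies outside $f^+$ or $g^+$, the convolution attains its tail at [y] and so dominates its
    value at [z]. Otherwise both functions increase up to [y], and its value at [y], the maximum of
    [f y] and [g y], dominates that at [x]. *)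
Lemma conv_convex f g : convex_fun (conv f g).
Proof.
move=> x y z xy yz; rewrite ge_min.
have zy : tail (conv f g) y <= conv f g y -> conv f g z <= conv f g y.
  by apply: le_trans; exact: le_tail.
have [fy|fy] := pselect (fplus f y); last first.
  rewrite zy ?orbT // tail_conv convE (tail_Nfplus (@L_convex _ f) fy).
  by rewrite le_max lexx.
have [gy|gy] := pselect (fplus g y); last first.
  rewrite zy ?orbT // tail_conv convE (tail_Nfplus (@L_convex _ g) gy).
  by rewrite le_max lexx orbT.
apply/orP; left; rewrite !convE (tail_fplus (@L_normal _ f) fy).
rewrite (tail_fplus (@L_normal _ g) gy) (tnorm_1r triT) (tnorm_1l triT).
move: fy gy => /fplusP fy /fplusP gy.
rewrite ge_max !le_max; apply/andP; split.
  by rewrite (le_trans (tri_lel _ _) (fy _ _ xy (lexx y))).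
by rewrite (le_trans (tri_ler _ _) (gy _ _ xy (lexx y))) orbT.
Qed.

Definition conv_L f g : L R := MkL (@conv_normal f g) (@conv_convex f g).

Lemma conv_1l f : conv (char_fun one01) f = f.
Proof.
apply/funext => x; apply/le_anti/andP; split.
  apply/convolutionP => y z; rewrite /char_fun; case: eqP => [->|_ _].
    by rewrite (min_idPr (i01_le1 z)) (tnorm_1l triT) => ->.
  by apply: le_trans (tri_lel _ _) (i01_ge0 _).
have := convolution_ge Order.min tri (char_fun one01) f one01 x.
by rewrite (min_idPr (i01_le1 x)) /char_fun eqxx (tnorm_1l triT).
Qed.

Lemma conv_LC : commutative conv_L.
Proof.
move=> f g; apply/L_eq/funext => x /=.
by rewrite !convE maxC !(tnormC triT (tail _ _)) (tnormC triT (g x)).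
Qed.

Lemma conv_LA : associative conv_L.
Proof.
move=> f g h; apply/L_eq/funext => x /=.
(* The inner convolutions must be seen as elements of $\mathbf{L}$ for [convE] to apply to the outer
   ones. *)
rewrite -[conv g h]/(conv_L g h : I -> I) -[conv f g]/(conv_L f g : I -> I).
by rewrite !convE /= !tail_conv !convE tri_maxl tri_maxr !(tnormA triT) maxA.
Qed.

End Convolution.

(** * The order of $\mathbf{L}$ in terms of tails *)

Section OrderL.
Variable R : realType.
Notation I := {i01 R}.

Lemma min_tnorm : is_tnorm (Order.min : I -> I -> I).
Proof.
split.
- exact: minA.
- exact: minC.
- by move=> z x y xy; rewrite le_min !ge_min xy lexx orbT.
- by move=> z x y xy; rewrite le_min !ge_min xy lexx orbT.
- by move=> x; apply: min_idPr; exact: i01_le1.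
- by move=> x; apply: min_idPl; exact: i01_le1.
Qed.

Lemma min_sup_continuous : sup_continuous_at_one (Order.min : I -> I -> I).
Proof.
move=> A u v A1 Av; have : Order.min (supI A) u <= v.
  by apply/minsupIP => t /Av; rewrite minC.
by rewrite A1 (min_idPr (i01_le1 u)).
Qed.

(** The identity [convE] for the t-norm [min] turns the order into the equation $f = (f \wedge g^R)
    \vee (f^R \wedge g)$, which splits into these inequalities. *)
Lemma le_LP (f g : L R) : (f <= g)%O <->
  (forall x, f x <= tail g x) /\ (forall x, Order.min (tail f x) (g x) <= f x).
Proof.
have meetE := convE min_tnorm min_sup_continuous f g.
split=> [/asboolP fg|[fg gf]].
  have fE x := etrans (esym (congr1 (fun h => h x) fg)) (meetE x).
  split=> x; rewrite fE; last by rewrite le_max lexx orbT.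
  by rewrite ge_max !ge_min lexx orbT (le_tail g (lexx x)) orbT.
apply/asboolP/funext => x; rewrite meetE (min_idPl (fg x)).
exact/max_idPl.
Qed.

End OrderL.

(** * Monotonicity of the convolution and the t-norm axioms on $\mathbf{L}$ *)

Section MonotoneConvolution.
Variables (R : realType) (tri : {i01 R} -> {i01 R} -> {i01 R}).
Hypothesis triT : is_tnorm tri.
Hypothesis tri1 : sup_continuous_at_one tri.
Implicit Types f g h : L R.

Local Notation T := (conv_L triT tri1).

Lemma conv_L_homol h : {homo (fun f => T f h) : f g / (f <= g)%O}.
Proof.
move=> f g /le_LP[fg gf]; apply/le_LP.
have tailfg x : tail f x <= tail g x.
  by apply: tail_le => y xy; apply: le_trans (fg y) _; apply: tail_le => z yz;
    apply: le_tail; exact: le_trans yz.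
split=> x; rewrite /= tail_conv // !convE //.
  by rewrite ge_max !(tri_le triT) ?le_tail.
(* Distributing leaves one bound for each term of the convolution of [g] and [h]. For the first,
   [tri] distributes over [min], and [gf] bounds [min (tail f x) (g x)] by [f x]. *)
rewrite min_maxr ge_max; apply/andP; split.
  by rewrite -(tri_minl triT) le_max (tri_le triT) ?gf.
(* For the second term: on $f^+$ the tail of [f] is 1 and dominates that of [g]; off $f^+$ it equals
   [f x], so the other member of the minimum is already [tri (f x) (tail h x)]. *)
rewrite le_max; have [fx|fx] := pselect (fplus f x).
  have f1 := tail_fplus (@L_normal _ f) fx.
  apply/orP; right; rewrite ge_min f1.
  by rewrite (tri_le triT (i01_le1 (tail g x)) (lexx (h x))) orbT.
by rewrite (tail_Nfplus (@L_convex _ f) fx) ge_min lexx.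
Qed.

Lemma conv_L_tnorm : is_tnorm T.
Proof.
split.
- exact: conv_LA.
- exact: conv_LC.
- exact: conv_L_homol.
- move=> h f g fg; rewrite !(conv_LC triT tri1 h); exact: conv_L_homol.
- by move=> f; apply: L_eq; exact: conv_1l.
- by move=> f; rewrite conv_LC; apply: L_eq; exact: conv_1l.
Qed.

End MonotoneConvolution.

Theorem proposition4p21 (R : realType) (tri : {i01 R} -> {i01 R} -> {i01 R})
    (tri_tnorm : is_tnorm tri) (tri_border : border_continuous tri) :
  (exists T : L R -> L R -> L R,
     (forall f g : L R, (T f g : {i01 R} -> {i01 R}) = convolution Order.min tri f g) /\
     is_tnorm T) /\
  (forall (f g : L R) (x : {i01 R}),
     [/\ x \in fplus f `&` fplus g ->
           convolution Order.min tri f g x = Order.max (f x) (g x),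
         x \in fplus g `\` fplus f -> convolution Order.min tri f g x = f x,
         x \in fplus f `\` fplus g -> convolution Order.min tri f g x = g x
       & x \notin fplus f `|` fplus g ->
           convolution Order.min tri f g x = tri (f x) (g x)]).
Proof.
have tri1 := border_sup_continuous tri_tnorm tri_border.
split.
  exists (conv_L tri_tnorm tri1); split=> //; exact: conv_L_tnorm.
move=> f g x.
have tail1 (h : L R) := @tail_fplus _ _ x (@L_normal _ h).
have tailE (h : L R) := @tail_Nfplus _ _ x (@L_convex _ h).
rewrite convE //; split.
- move=> /set_mem[fx gx].
  by rewrite !tail1 // (tnorm_1l tri_tnorm) (tnorm_1r tri_tnorm).
(* The formula reduces to the maximum of [f x] and [tri (f x) (g x)], and a t-norm lies below its
   factors. *)
- move=> /set_mem[gx fx]; rewrite (tail1 g) // (tailE f) // (tnorm_1r tri_tnorm).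
  exact/max_idPl/tri_lel.
- move=> /set_mem[fx gx]; rewrite (tail1 f) // (tailE g) // (tnorm_1l tri_tnorm).
  exact/max_idPr/tri_ler.
- move=> /negP fgx.
  have fx : ~ fplus f x by move=> fx; apply: fgx; apply/mem_set; left.
  have gx : ~ fplus g x by move=> gx; apply: fgx; apply/mem_set; right.
  by rewrite !tailE // maxxx.
Qed.
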